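(* Let $\mathcal E$ be a Heyting category and let $(A',A)$ be an OPCA pair in $\mathcal E$. Then there is a pseudoinitial regular model for $(A',A)$; that is, there is a regular model $(N,D)$ for $(A',A)$ such that for every regular model $(F,C)$ for $(A',A)$ there is, up to isomorphism, a unique morphism of regular models $(N,D)\to(F,C)$.
   Context: A Heyting category is a regular category in which every poset $\mathrm{Sub}(X)$ of subobjects is a Heyting algebra and every inverse image map $f^{-1}:\mathrm{Sub}(Y)\to\mathrm{Sub}(X)$ (for $f:X\to Y$) has a left adjoint $\exists_f$ and a right adjoint $\forall_f$. Formulas about elements are read in the internal language. An object is inhabited if its map to the terminal object is a regular epimorphism; two subobjects $U,V$ of an object intersect if $U\cap V$ is inhabited. A functor between regular categories is regular if it preserves finite limits and regular epimorphisms. OPAS: an object $A$ with a partial order $\leq$ and a monotone partial binary operator $(x,y)\mapsto xy$ (application) whose domain is a downward closed subobject of $A\times A$. Write $xy\downarrow z$ for ''$xy$ is defined and equals $z$'', and $xy\downarrow$ for ''$xy$ is defined''. A partial arrow $f:U\subseteq A^n\to A$ is representable if the subobject $[\![f]\!]=\{a\in A\mid \forall \vec x\in U.\,\exists y\in A.\ y\leq f(\vec x)\wedge ((ax_1)\dots)x_n\downarrow y\}$ of $A$ is inhabited. The partial combinatory arrows are the least collection of partial arrows $A^n\rightharpoonup A$ (any $n\in\mathbb N$) that contains the projections and is closed under pointwise application. An OPCA is an OPAS in which every partial combinatory arrow is representable. OPCA pair $(A',A)$: a pair of OPASes such that $A'$ is a subobject of $A$, application in $A'$ is the restriction of application in $A$;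 if $x,y\in A'$ and $xy\downarrow z$ in $A$ then $z\in A'$; and for every partial combinatory arrow $f$ of $A$, $[\![f]\!]$ intersects $A'$. For a regular functor $F:\mathcal E\to\mathcal C$ to a regular category $\mathcal C$, an $F$-filter is a subobject $C\leq FA$ such that (internally in $\mathcal C$): if $x\in C$ and $x\leq y$ then $y\in C$; if $x,y\in C$ and $xy\downarrow z$ for some $z\in FA$ then $z\in C$; and (externally) for every subobject $U\subseteq A$ that intersects $A'$, $FU$ intersects $C$. A regular model for $(A',A)$ is a pair $(F,C)$ consisting of a regular functor $F:\mathcal E\to\mathcal C$ to a regular category and an $F$-filter $C$. A morphism $(F:\mathcal E\to\mathcal C,\,C)\to(G:\mathcal E\to\mathcal D,\,D)$ is a regular functor $H:\mathcal C\to\mathcal D$ together with a natural isomorphism $\eta:HF\to G$ such that $\eta_A:HFA\to GA$ restricts to an isomorphism between $HC$ and $D$. *)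

(* Defs.v *)
From mathcomp Require Import ssreflect ssrfun ssrbool eqtype ssrnat seq fintype.

Set Implicit Arguments.
Unset Strict Implicit.
Unset Printing Implicit Defensive.

Declare Scope cat_scope.
Delimit Scope cat_scope with cat.
Local Open Scope cat_scope.

Reserved Notation "g ∘ f" (at level 40, left associativity).
Reserved Notation "⟨ f , g ⟩" (at level 0, format "⟨ f ,  g ⟩").

(** * Categories *)

Record Category := {
  Ob :> Type;
  Hom : Ob -> Ob -> Type;
  idn : forall X, Hom X X;
  comp : forall X Y Z, Hom Y Z -> Hom X Y -> Hom X Z;
  comp_idl : forall X Y (f : Hom X Y), comp (idn Y) f = f;
  comp_idr : forall X Y (f : Hom X Y), comp f (idn X) = f;
  comp_assoc : forall X Y Z W (h : Hom Z W) (g : Hom Y Z) (f : Hom X Y),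
    comp h (comp g f) = comp (comp h g) f }.

Arguments Hom {c} X Y : rename.
Arguments idn {c} X : rename.
Arguments comp {c X Y Z} g f : rename.
Notation "g ∘ f" := (comp g f) : cat_scope.

Section Arrows.
Variable C : Category.

Definition mono (X Y : C) (m : Hom X Y) : Prop :=
  forall T (f g : Hom T X), m ∘ f = m ∘ g -> f = g.

Definition is_iso (X Y : C) (f : Hom X Y) : Prop :=
  exists g : Hom Y X, g ∘ f = idn X /\ f ∘ g = idn Y.

Definition is_terminal (T : C) : Prop :=
  forall X, exists! f : Hom X T, True.

Definition is_pullback (X Y Z P : C) (f : Hom X Z) (g : Hom Y Z)
    (p : Hom P X) (q : Hom P Y) : Prop :=
  f ∘ p = g ∘ q /\
  forall T (x : Hom T X) (y : Hom T Y), f ∘ x = g ∘ y ->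
    exists! h : Hom T P, p ∘ h = x /\ q ∘ h = y.

Definition is_coequalizer (K X Q : C) (f g : Hom K X) (q : Hom X Q) : Prop :=
  q ∘ f = q ∘ g /\
  forall T (t : Hom X T), t ∘ f = t ∘ g -> exists! h : Hom Q T, h ∘ q = t.

Definition regular_epi (X Y : C) (e : Hom X Y) : Prop :=
  exists (K : C) (f g : Hom K X), is_coequalizer f g e.

(* Subobjects are represented by monomorphisms; equality of subobjects is
   mutual inclusion for [sub_le]. *)
Record Sub (X : C) := {
  sub_ob :> C;
  sub_arr : Hom sub_ob X;
  sub_mono : mono sub_arr }.

Definition sub_le (X : C) (U V : Sub X) : Prop :=
  exists k : Hom U V, sub_arr V ∘ k = sub_arr U.

(* The generalized element [x] of [X] belongs to the subobject [U]. *)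
Definition belongs (T X : C) (x : Hom T X) (U : Sub X) : Prop :=
  exists k : Hom T U, sub_arr U ∘ k = x.

Lemma mono_comp (X Y Z : C) (g : Hom Y Z) (f : Hom X Y) :
  mono g -> mono f -> mono (g ∘ f).
Proof.
by move=> mg mf T a b; rewrite -!comp_assoc => /mg /mf.
Qed.

Lemma mono_id (X : C) : mono (idn X).
Proof. by move=> T a b; rewrite !comp_idl. Qed.

Definition sub_top (X : C) : Sub X := Build_Sub (@mono_id X).

Definition sub_comp (X : C) (U : Sub X) (V : Sub (sub_ob U)) : Sub X :=
  Build_Sub (mono_comp (sub_mono (s := U)) (sub_mono (s := V))).

Lemma mono_pullback (X Y Z P : C) (f : Hom X Z) (g : Hom Y Z)
    (p : Hom P X) (q : Hom P Y) :
  is_pullback f g p q -> mono g -> mono p.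
Proof.
move=> [sq up] mg T a b eab.
have eq2 : q ∘ a = q ∘ b.
  by apply: mg; rewrite !comp_assoc -sq -!comp_assoc eab.
have [|h [_ hu]] := up T (p ∘ a) (q ∘ a); first by rewrite !comp_assoc sq.
by rewrite -(hu a) // -(hu b).
Qed.

Lemma mono_kernel_pair (X Y : C) (m : Hom X Y) :
  mono m <-> is_pullback m m (idn X) (idn X).
Proof.
split=> [mm | [_ up] T a b eab].
- split=> // T x y /mm <-; exists x; split; first by rewrite comp_idl.
  by move=> h []; rewrite comp_idl.
- have [h [[]]] := up T a b eab.
  by rewrite comp_idl => -> ->.
Qed.

End Arrows.

(** * Regular and Heyting categories *)

(* The universal objects are chosen; pullbacks and a terminal object yield all
   finite limits. *)
Record RegularCategory := {
  reg_cat :> Category;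
  one : reg_cat;
  bang : forall X, Hom X one;
  bang_uniq : forall X (f : Hom X one), f = bang X;
  prd : reg_cat -> reg_cat -> reg_cat;
  pr1 : forall X Y, Hom (prd X Y) X;
  pr2 : forall X Y, Hom (prd X Y) Y;
  pairing : forall T X Y, Hom T X -> Hom T Y -> Hom T (prd X Y);
  pr1_pairing : forall T X Y (x : Hom T X) (y : Hom T Y),
    pr1 X Y ∘ pairing x y = x;
  pr2_pairing : forall T X Y (x : Hom T X) (y : Hom T Y),
    pr2 X Y ∘ pairing x y = y;
  pairing_uniq : forall T X Y (h : Hom T (prd X Y)),
    h = pairing (pr1 X Y ∘ h) (pr2 X Y ∘ h);
  pb : forall X Y Z, Hom X Z -> Hom Y Z -> reg_cat;
  pb1 : forall X Y Z (f : Hom X Z) (g : Hom Y Z), Hom (pb f g) X;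
  pb2 : forall X Y Z (f : Hom X Z) (g : Hom Y Z), Hom (pb f g) Y;
  pbP : forall X Y Z (f : Hom X Z) (g : Hom Y Z),
    is_pullback f g (pb1 f g) (pb2 f g);
  kernel_pair_coeq : forall X Y (f : Hom X Y),
    exists (Q : reg_cat) (q : Hom X Q), is_coequalizer (pb1 f f) (pb2 f f) q;
  regular_epi_pb : forall X Y Z (f : Hom X Z) (g : Hom Y Z),
    regular_epi g -> regular_epi (pb1 f g) }.

Arguments one {r} : rename.
Arguments bang {r} X : rename.
Arguments prd {r} X Y : rename.
Arguments pr1 {r X Y} : rename.
Arguments pr2 {r X Y} : rename.
Arguments pairing {r T X Y} x y : rename.
Arguments pb {r X Y Z} f g : rename.
Arguments pb1 {r X Y Z} f g : rename.
Arguments pb2 {r X Y Z} f g : rename.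
Notation "⟨ f , g ⟩" := (pairing f g) : cat_scope.

Section Subobjects.
Variable C : RegularCategory.

Definition inhabited_ob (X : C) : Prop := regular_epi (bang X).

Definition preimage (X Y : C) (f : Hom X Y) (V : Sub Y) : Sub X :=
  Build_Sub (mono_pullback (pbP f (sub_arr V)) (sub_mono (s := V))).

Definition preimage_map (X Y : C) (f : Hom X Y) (V : Sub Y) :
  Hom (preimage f V) V := pb2 f (sub_arr V).

Definition sub_meet (X : C) (U V : Sub X) : Sub X :=
  sub_comp (preimage (sub_arr U) V).

Definition intersect (X : C) (U V : Sub X) : Prop :=
  inhabited_ob (sub_meet U V).

End Subobjects.

Record HeytingAlgebra (L : Type) (le : L -> L -> Prop) := {
  h_refl : forall a, le a a;
  h_trans : forall a b c, le a b -> le b c -> le a c;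
  h_top : L;
  h_bot : L;
  h_meet : L -> L -> L;
  h_join : L -> L -> L;
  h_imp : L -> L -> L;
  h_topP : forall a, le a h_top;
  h_botP : forall a, le h_bot a;
  h_meetP : forall a b c, le c (h_meet a b) <-> le c a /\ le c b;
  h_joinP : forall a b c, le (h_join a b) c <-> le a c /\ le b c;
  h_impP : forall a b c, le c (h_imp a b) <-> le (h_meet c a) b }.

Record HeytingCategory := {
  hey_reg :> RegularCategory;
  sub_heyting : forall X : hey_reg, HeytingAlgebra (@sub_le hey_reg X);
  ex_im : forall X Y : hey_reg, Hom X Y -> Sub X -> Sub Y;
  ex_imP : forall (X Y : hey_reg) (f : Hom X Y) (U : Sub X) (V : Sub Y),
    sub_le (ex_im f U) V <-> sub_le U (preimage f V);
  all_im : forall X Y : hey_reg, Hom X Y -> Sub X -> Sub Y;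
  all_imP : forall (X Y : hey_reg) (f : Hom X Y) (U : Sub X) (V : Sub Y),
    sub_le V (all_im f U) <-> sub_le (preimage f V) U }.

Arguments ex_im {h X Y} f U : rename.
Arguments all_im {h X Y} f U : rename.

(** * Ordered partial applicative structures *)

Section OPAS.
Variable E : RegularCategory.

(* Horn conditions of the internal language are stated on generalized
   elements. [rel R x y] reads "(x, y) belongs to R", and [app_to op x y z]
   reads "the partial operator [op] is defined at (x, y), with value z". *)
Definition rel (A : E) (R : Sub (prd A A)) (T : E) (x y : Hom T A) : Prop :=
  belongs ⟨x, y⟩ R.

Definition app_to (A : E) (D : Sub (prd A A)) (op : Hom D A)
    (T : E) (x y z : Hom T A) : Prop :=
  exists d : Hom T D, sub_arr D ∘ d = ⟨x, y⟩ /\ op ∘ d = z.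

Record OPAS := {
  carrier :> E;
  ole : Sub (prd carrier carrier);
  app_dom : Sub (prd carrier carrier);
  app : Hom app_dom carrier;
  ole_refl : forall T (x : Hom T carrier), rel ole x x;
  ole_trans : forall T (x y z : Hom T carrier),
    rel ole x y -> rel ole y z -> rel ole x z;
  ole_anti : forall T (x y : Hom T carrier),
    rel ole x y -> rel ole y x -> x = y;
  app_down : forall T (x y x' y' : Hom T carrier),
    rel ole x' x -> rel ole y' y -> rel app_dom x y -> rel app_dom x' y';
  app_monotone : forall T (x y z x' y' z' : Hom T carrier),
    rel ole x' x -> rel ole y' y -> app_to app x y z -> app_to app x' y' z' ->
    rel ole z' z }.

Record parrow (X Y : E) := {
  pdom : Sub X;
  pval : Hom pdom Y }.

Definition total (X Y : E) (f : Hom X Y) : parrow X Y :=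
  @Build_parrow X Y (sub_top X) f.

Lemma graph_mono (X Y : E) (f : parrow X Y) : mono ⟨sub_arr (pdom f), pval f⟩.
Proof.
move=> T a b eab; apply: (@sub_mono _ _ (pdom f)).
by rewrite -(pr1_pairing (sub_arr (pdom f)) (pval f)) -!comp_assoc eab.
Qed.

Definition graph (X Y : E) (f : parrow X Y) : Sub (prd X Y) :=
  Build_Sub (graph_mono (f := f)).

(* Pointwise application: x |-> f(x) g(x), with domain the x where f(x), g(x)
   and f(x) g(x) are all defined. *)
Definition papp (A : OPAS) (X : E) (f g : parrow X A) : parrow X A :=
  let U := sub_meet (pdom f) (pdom g) in
  let fU : Hom U A := pval f ∘ pb1 (sub_arr (pdom f)) (sub_arr (pdom g)) in
  let gU : Hom U A := pval g ∘ pb2 (sub_arr (pdom f)) (sub_arr (pdom g)) in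
  @Build_parrow X A (sub_comp (preimage ⟨fU, gU⟩ (app_dom A)))
    (app A ∘ preimage_map ⟨fU, gU⟩ (app_dom A)).

Fixpoint power (A : E) (n : nat) : E :=
  if n is n'.+1 then prd A (power A n') else one.

Fixpoint proj (A : E) (n : nat) : 'I_n -> Hom (power A n) A :=
  match n return 'I_n -> Hom (power A n) A with
  | 0 => fun i => False_rect _ (notF (ltn_ord i))
  | n'.+1 => fun i =>
      if unlift ord0 i is Some j then proj A j ∘ pr2 else pr1
  end.

Inductive combinatory (A : OPAS) (n : nat) : parrow (power A n) A -> Prop :=
| comb_proj (i : 'I_n) : combinatory (total (proj A i))
| comb_app (f g : parrow (power A n) A) :
    combinatory f -> combinatory g -> combinatory (papp f g).

End OPAS.

Arguments ole {E} o : rename.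
Arguments app_dom {E} o : rename.
Arguments app {E} o : rename.

Section OPCA.
Variable E : HeytingCategory.

(* The interpretation of
     {a in A | forall x in U. exists y in A.
                 y <= f(x) /\ ((a x_1) ...) x_n is defined and equal to y}
   where U is the domain of f; [iapp] is the partial arrow
   (a, x) |-> ((a x_1) ...) x_n on A * U. *)
Definition realizers (A : OPAS E) (n : nat) (f : parrow (power A n) A) :
    Sub (carrier A) :=
  let U : E := pdom f in
  let iapp : parrow (prd (carrier A) U) A :=
    foldl (@papp E A _) (total pr1)
      [seq total (proj A i ∘ (sub_arr (pdom f) ∘ pr2)) | i <- enum 'I_n] in
  let below : Sub (prd (prd (carrier A) U) A) :=
    preimage ⟨pr2, pval f ∘ (pr2 ∘ pr1)⟩ (ole A) in
  all_im (pr1 : Hom (prd (carrier A) U) A)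
    (ex_im (pr1 : Hom (prd (prd (carrier A) U) A) (prd (carrier A) U))
       (sub_meet below (graph iapp))).

Record OPCAPair := {
  opA' : OPAS E;
  opA : OPAS E;
  incl : Hom (carrier opA') (carrier opA);
  incl_mono : mono incl;
  app_restr : forall (T : E) (x y z : Hom T (carrier opA')),
    app_to (app opA') x y z <->
    app_to (app opA) (incl ∘ x) (incl ∘ y) (incl ∘ z);
  app_closed : forall (T : E) (x y : Hom T (carrier opA'))
      (z : Hom T (carrier opA)),
    app_to (app opA) (incl ∘ x) (incl ∘ y) z ->
    belongs z (Build_Sub incl_mono);
  comb_realized : forall (n : nat) (f : parrow (power opA n) opA),
    combinatory f -> intersect (realizers f) (Build_Sub incl_mono) }.

Definition opsub (P : OPCAPair) : Sub (carrier (opA P)) :=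
  Build_Sub (incl_mono (o := P)).

End OPCA.

(** * Functors and regular models *)

Record Functor (C D : Category) := {
  fob :> C -> D;
  fmap : forall X Y : C, Hom X Y -> Hom (fob X) (fob Y);
  fmap_id : forall X, fmap (idn X) = idn (fob X);
  fmap_comp : forall X Y Z (g : Hom Y Z) (f : Hom X Y),
    fmap (g ∘ f) = fmap g ∘ fmap f }.

Arguments fmap {C D} F {X Y} f : rename.

Definition functor_comp (C D K : Category) (G : Functor D K) (F : Functor C D) :
  Functor C K.
Proof.
refine {| fob := fun X => G (F X);
          fmap := fun X Y (f : Hom X Y) => fmap G (fmap F f) |}.
- by move=> X; rewrite !fmap_id.
- by move=> X Y Z g f; rewrite !fmap_comp.
Defined.

Record NatIso (C D : Category) (F G : Functor C D) := {
  nat_at :> forall X : C, Hom (F X) (G X);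
  nat_natural : forall (X Y : C) (f : Hom X Y),
    nat_at Y ∘ fmap F f = fmap G f ∘ nat_at X;
  nat_iso : forall X, is_iso (nat_at X) }.

Record RegularFunctor (C D : RegularCategory) := {
  rfun :> Functor C D;
  pres_terminal : forall T : C, is_terminal T -> is_terminal (rfun T);
  pres_pullback : forall (X Y Z P : C) (f : Hom X Z) (g : Hom Y Z)
      (p : Hom P X) (q : Hom P Y),
    is_pullback f g p q ->
    is_pullback (fmap rfun f) (fmap rfun g) (fmap rfun p) (fmap rfun q);
  pres_regular_epi : forall (X Y : C) (e : Hom X Y),
    regular_epi e -> regular_epi (fmap rfun e) }.

Section FunctorSub.
Variables (C D : RegularCategory) (F : RegularFunctor C D).

Lemma pres_mono (X Y : C) (m : Hom X Y) : mono m -> mono (fmap F m).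
Proof.
move=> /mono_kernel_pair /(pres_pullback F); rewrite !fmap_id.
by move=> /mono_kernel_pair.
Qed.

Definition fsub (X : C) (U : Sub X) : Sub (F X) :=
  Build_Sub (pres_mono (sub_mono (s := U))).

(* For generalized elements x, y, z of F A: (x, y) belongs to F R, and the
   image under F of a partial operator on A is defined at (x, y) with value z;
   F (A * A) is a product of F A with itself via F pr1 and F pr2. *)
Definition frel (A : C) (R : Sub (prd A A)) (T : D) (x y : Hom T (F A)) :
    Prop :=
  exists r : Hom T (F R), fmap F pr1 ∘ (fmap F (sub_arr R) ∘ r) = x /\
                          fmap F pr2 ∘ (fmap F (sub_arr R) ∘ r) = y.

Definition fapp_to (A : C) (R : Sub (prd A A)) (op : Hom R A)
    (T : D) (x y z : Hom T (F A)) : Prop :=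
  exists d : Hom T (F R), [/\ fmap F pr1 ∘ (fmap F (sub_arr R) ∘ d) = x,
                              fmap F pr2 ∘ (fmap F (sub_arr R) ∘ d) = y &
                              fmap F op ∘ d = z].

End FunctorSub.

Section Models.
Variables (E : HeytingCategory) (P : OPCAPair E).

Record is_filter (C : RegularCategory) (F : RegularFunctor E C)
    (Fl : Sub (F (carrier (opA P)))) : Prop := {
  filter_up : forall (T : C) (x y : Hom T (F (carrier (opA P)))),
    belongs x Fl -> frel (ole (opA P)) x y -> belongs y Fl;
  filter_app : forall (T : C) (x y z : Hom T (F (carrier (opA P)))),
    belongs x Fl -> belongs y Fl -> fapp_to (app (opA P)) x y z ->
    belongs z Fl;
  filter_meets : forall U : Sub (carrier (opA P)),
    intersect U (opsub P) -> intersect (fsub F U) Fl }.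

Record RegularModel := {
  mcat : RegularCategory;
  mfun : RegularFunctor E mcat;
  mfil : Sub (mfun (carrier (opA P)));
  mfilP : is_filter mfil }.

Record ModelMorphism (M M' : RegularModel) := {
  mor_fun : RegularFunctor (mcat M) (mcat M');
  mor_iso : NatIso (functor_comp mor_fun (mfun M)) (mfun M');
  mor_fil : exists k : Hom (mor_fun (mfil M)) (mfil M'),
    is_iso k /\
    sub_arr (mfil M') ∘ k =
      mor_iso (carrier (opA P)) ∘ fmap mor_fun (sub_arr (mfil M)) }.

(* Two morphisms (H, eta), (K, kappa) are isomorphic when there is a natural
   isomorphism theta : H -> K with kappa_X o theta_(F X) = eta_X, F being the
   functor of the source model. *)
Definition mor_isomorphic (M M' : RegularModel) (f g : ModelMorphism M M') :
    Prop :=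
  exists theta : NatIso (mor_fun f) (mor_fun g),
    forall X : E, (mor_iso g X : Hom (mor_fun g (mfun M X)) (mfun M' X)) ∘
                  theta (mfun M X) = mor_iso f X.

Definition pseudoinitial (M : RegularModel) : Prop :=
  forall M' : RegularModel,
    inhabited (ModelMorphism M M') /\
    forall f g : ModelMorphism M M', mor_isomorphic f g.

End Models.

(* Main.v *)
From Stdlib Require Import ProofIrrelevance IndefiniteDescription.
From mathcomp Require Import ssreflect ssrfun ssrbool.
Require Import Defs.

Set Implicit Arguments.
Unset Strict Implicit.
Unset Printing Implicit Defensive.
Local Open Scope cat_scope.

(** A regular model consists of a regular functor on [E] and a predicate on the
    image of [A] that satisfies closure conditions, each of them a sequent of
    regular logic. So the models are those of a regular theory, and the
    pseudoinitial model is its classifying category. This category is built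
    here from formulas for its objects and from semantic entailment for its
    arrows.

    Objects.  The [formula]s over an object [X] of [E] are built from the atom
    saying that an element of [A] is in the filter, with truth, substitution,
    conjunction and existential quantification along regular epimorphisms. In a
    model [M] over [F : E -> C] a formula over [X] has an extension, a subobject
    of [F X] ([ext]). An object of the classifying category is an object of [E]
    with a formula over it.

    Arrows.  An arrow [(X, phi) -> (Y, psi)] is an arrow [f : X -> Y] of [E]
    such that in every model [F f] maps the extension of [phi] into that of
    [psi]. In a classifying category one expects provably functional relations,
    but arrows of [E] suffice: [E] itself, with the identity functor and all of
    [A] as filter, is a model, in which all formulas are valid
    ([trivial_model_valid]), so every provably functional relation is already
    the graph of an arrow of [E].

    Regularity.  Every model [M] gives a functor [realize M], which sends
    [(X, phi)] to its extension. The crucial fact is [cls_regular_epi]: an arrow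
    [f] is a regular epimorphism iff [realize M f] is one for all [M]. If all
    [realize M f] are regular epimorphisms, then the trivial model shows that
    [f] is one in [E], so that it is a coequalizer there, and the arrows
    induced by this coequalizer preserve formulas because that can be checked
    locally ([cls_coequalizer]). Conversely, [f] factors through the existential
    quantification of [phi] along the first part of its image factorization in
    [E] ([cls_image]). With this, stability of regular epimorphisms under
    pullback, regularity of [realize M] and of the inclusion of [E], and the
    filter axioms for the object [(A, x is in the filter)] all reduce to the
    corresponding facts in each model.

    Pseudoinitiality.  Existence of a morphism to [M] is [realize_morphism]. For
    uniqueness, a morphism [K] to [M] turns the mono from [(X, phi)] to
    [(X, true)] into a subobject of [F X]. By induction on [phi], this subobject
    is the extension of [phi] ([mor_subE]), because all the connectives are
    pullbacks and regular images, which [K] preserves. So the values of any two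
    morphisms are the same subobjects, and the comparison between them is
    automatically natural ([mor_unique]).

    Reasoning inside a regular category is done with generalized elements, in
    the style of Kripke and Joyal: an existential statement holds at a stage [T]
    when a witness exists after a change of stage along a regular epimorphism
    into [T] ([in_image]). *)

(** * Regular epimorphisms and images *)

Section Categories.
Variable C : Category.

Lemma coequalizer_regular_epi (X Y K : C) (f g : Hom K X) (e : Hom X Y) :
  is_coequalizer f g e -> regular_epi e.
Proof. by exists K, f, g. Qed.

Lemma regular_epi_cancel (X Y Z : C) (e : Hom X Y) (a b : Hom Y Z) :
  regular_epi e -> a ∘ e = b ∘ e -> a = b.
Proof.
move=> [K [f [g [ce ue]]]] eab.
have [|h [_ hu]] := ue Z (a ∘ e); first by rewrite -!comp_assoc ce.
by rewrite -(hu a) // (hu b).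
Qed.

(** Membership in a subobject is a local property, because a regular
    epimorphism is orthogonal to monos. *)
Lemma belongs_descent (T' T X : C) (e : Hom T' T) (x : Hom T X) (U : Sub X) :
  regular_epi e -> belongs (x ∘ e) U -> belongs x U.
Proof.
move=> re [u eu]; have [K [f [g [ce ue]]]] := re.
have [|k [ku _]] := ue U u.
  by apply: (@sub_mono _ _ U); rewrite !comp_assoc eu -!comp_assoc ce.
exists k; apply: (regular_epi_cancel re).
by rewrite -comp_assoc ku.
Qed.

Lemma belongs_comp (T' T X : C) (x : Hom T X) (e : Hom T' T) (U : Sub X) :
  belongs x U -> belongs (x ∘ e) U.
Proof. by move=> [k <-]; exists (k ∘ e); rewrite comp_assoc. Qed.

Lemma belongs_self (X : C) (U : Sub X) : belongs (sub_arr U) U.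
Proof. by exists (idn _); rewrite comp_idr. Qed.

Lemma iso_regular_epi (X Y : C) (f : Hom X Y) : is_iso f -> regular_epi f.
Proof.
move=> [g [gf fg]]; exists X, (idn X), (idn X); split=> // T t _.
exists (t ∘ g); split; first by rewrite -comp_assoc gf comp_idr.
by move=> h <-; rewrite -comp_assoc fg comp_idr.
Qed.

Lemma iso_comp_regular_epi (X Y Z : C) (m : Hom Y Z) (q : Hom X Y) :
  is_iso m -> regular_epi q -> regular_epi (m ∘ q).
Proof.
move=> [n [nm mn]] [K [f [g [cq uq]]]]; exists K, f, g.
split=> [|T t /uq [h [hq hu]]]; first by rewrite -!comp_assoc cq.
exists (h ∘ n); split.
  by rewrite comp_assoc -(comp_assoc h) nm comp_idr.
move=> k kmq; rewrite (hu (k ∘ m)) -?comp_assoc //.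
by rewrite mn comp_idr.
Qed.

Lemma sub_iso (X : C) (U : Sub X) : belongs (idn X) U -> is_iso (sub_arr U).
Proof.
move=> [k mk]; exists k; split=> //; apply: (@sub_mono _ _ U).
by rewrite comp_assoc mk comp_idl comp_idr.
Qed.

Lemma iso_mono (X Y : C) (f : Hom X Y) : is_iso f -> mono f.
Proof.
move=> [g [gf _]] T a b eab.
by rewrite -(comp_idl a) -(comp_idl b) -gf -!comp_assoc eab.
Qed.

(** The universal property of a coequalizer only sees the arrows that it has
    to coequalize, and the kernel pair is the largest such pair. *)
Lemma regular_epi_kernel_pair (X Y K : C) (e : Hom X Y) (p q : Hom K X) :
  regular_epi e -> is_pullback e e p q -> is_coequalizer p q e.
Proof.
move=> [L [f [g [ce ue]]]] [epq up]; split=> // T t tpq.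
have [h [[hp hq] _]] := up _ f g ce.
by apply: ue; rewrite -hp -hq !comp_assoc tpq.
Qed.

End Categories.

Section RegularCategories.
Variable C : RegularCategory.

Lemma pb_lift (T X Y Z : C) (f : Hom X Z) (g : Hom Y Z) (x : Hom T X)
    (y : Hom T Y) : f ∘ x = g ∘ y ->
  exists h : Hom T (pb f g), pb1 f g ∘ h = x /\ pb2 f g ∘ h = y.
Proof. by move=> /(proj2 (pbP f g) T) [h [? _]]; exists h. Qed.

Lemma one_uniq (T : C) (f g : Hom T one) : f = g.
Proof. by rewrite (bang_uniq f) (bang_uniq g). Qed.

Lemma belongs_top (T X : C) (x : Hom T X) : belongs x (sub_top X).
Proof. by exists x; rewrite comp_idl. Qed.

Lemma belongs_preimage (T X Y : C) (f : Hom X Y) (V : Sub Y) (x : Hom T X) :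
  belongs x (preimage f V) <-> belongs (f ∘ x) V.
Proof.
split=> [[k <-]|[k /esym /pb_lift [h [hx _]]]]; last by exists h.
exists (pb2 f (sub_arr V) ∘ k); rewrite !comp_assoc.
by rewrite (proj1 (pbP f (sub_arr V))).
Qed.

Lemma belongs_meet (T X : C) (U V : Sub X) (x : Hom T X) :
  belongs x (sub_meet U V) <-> belongs x U /\ belongs x V.
Proof.
split=> [[k <-]|[[u <-]] /belongs_preimage [k kx]].
  split; first by exists (pb1 (sub_arr U) (sub_arr V) ∘ k); rewrite comp_assoc.
  by rewrite -comp_assoc; apply/belongs_preimage; exists k.
by exists k; rewrite /= -comp_assoc; congr (_ ∘ _).
Qed.

(** The coequalizer [q] of the kernel pair of [f] is followed by a mono: two
    elements of its codomain lift to the domain of [f] after a change of stage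
    along regular epimorphisms, where equality of their images in [Y] says that
    they come from the kernel pair. *)
Lemma image_factorization (X Y : C) (f : Hom X Y) :
  exists (I : Sub Y) (q : Hom X I),
    is_coequalizer (pb1 f f) (pb2 f f) q /\ sub_arr I ∘ q = f.
Proof.
have [Q [q cq]] := kernel_pair_coeq f.
have rq := coequalizer_regular_epi cq.
have [m [mq _]] := proj2 cq Y f (proj1 (pbP f f)).
suff mm : mono m by exists (Build_Sub mm), q.
move=> T a b mab.
pose T1 := pb a q; pose b1 : Hom T1 Q := b ∘ pb1 a q; pose T2 := pb b1 q.
have r1 : regular_epi (pb1 a q) by apply: regular_epi_pb.
have r2 : regular_epi (pb1 b1 q) by apply: regular_epi_pb.
apply: (regular_epi_cancel r1); apply: (regular_epi_cancel r2).
have sa := proj1 (pbP a q); have sb := proj1 (pbP b1 q).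
rewrite -/b1 sb sa -comp_assoc.
have [|h [<- <-]] := @pb_lift T2 _ _ _ f f (pb2 a q ∘ pb1 b1 q) (pb2 b1 q).
  rewrite -mq -!comp_assoc -sb (comp_assoc q) -sa /b1.
  by rewrite !comp_assoc mab.
by rewrite !comp_assoc (proj1 cq).
Qed.

(** The image of such an [f] is all of [Y], so that [f] agrees up to isomorphism
    with the coequalizer of its kernel pair. *)
Lemma regular_epi_extremal (X Y : C) (f : Hom X Y) :
  (forall V : Sub Y, belongs f V -> belongs (idn Y) V) -> regular_epi f.
Proof.
move=> cov; have [I [q [cq mq]]] := image_factorization f.
rewrite -mq; apply: iso_comp_regular_epi; last exact: coequalizer_regular_epi cq.
by apply: sub_iso; apply: cov; exists q.
Qed.

Lemma regular_epi_factor (X Y Z : C) (f : Hom X Y) (g : Hom Y Z) :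
  regular_epi (g ∘ f) -> regular_epi g.
Proof.
move=> r; apply: regular_epi_extremal => V gV.
by apply: (belongs_descent r); rewrite comp_idl; apply: belongs_comp.
Qed.

(** Forcing of an existential statement: the element [y] is [f] of an element
    of [U] after a change of stage along a regular epimorphism. *)
Definition in_image (X Y : C) (f : Hom X Y) (U : Sub X) (T : C) (y : Hom T Y) :
    Prop :=
  exists (T' : C) (e : Hom T' T) (u : Hom T' X),
    [/\ regular_epi e, belongs u U & f ∘ u = y ∘ e].

Lemma regular_epi_in_image (X Y : C) (f : Hom X Y) (T : C) (y : Hom T Y) :
  regular_epi f -> in_image f (sub_top X) y.
Proof.
move=> rf; exists _, (pb1 y f), (pb2 y f); split.
- exact: regular_epi_pb.
- exact: belongs_top.
- by rewrite (proj1 (pbP y f)).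
Qed.

(** Direct images are given as subobjects by their forcing condition, which is
    all that is used of them. *)
Lemma image_exists (X Y : C) (f : Hom X Y) (U : Sub X) :
  exists V : Sub Y, forall (T : C) (y : Hom T Y),
    belongs y V <-> in_image f U y.
Proof.
have [I [q [cq mq]]] := image_factorization (f ∘ sub_arr U).
have rq := coequalizer_regular_epi cq.
exists I => T y; split=> [[k <-]|[T' [e [_ [re [v <-] fy]]]]].
  have [T' [e [x [re _ qx]]]] := regular_epi_in_image k rq.
  exists T', e, (sub_arr U ∘ x); split=> //; first by exists x.
  by rewrite comp_assoc -mq -!comp_assoc qx.
by apply: (belongs_descent re); exists (q ∘ v); rewrite -fy !comp_assoc mq.
Qed.

Definition image (X Y : C) (f : Hom X Y) (U : Sub X) : Sub Y :=
  sval (constructive_indefinite_description _ (image_exists f U)).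

Lemma belongs_image (X Y : C) (f : Hom X Y) (U : Sub X) (T : C)
    (y : Hom T Y) : belongs y (image f U) <-> in_image f U y.
Proof.
exact: (proj2_sig (constructive_indefinite_description _ (image_exists f U))).
Qed.

(** Surjectivity of a restricted arrow can be expressed without mentioning the
    restriction. For the converse, the generic element of [V] is enough. *)
Lemma restriction_regular_epi (X Y : C) (f : Hom X Y) (U : Sub X) (V : Sub Y)
    (h : Hom U V) : sub_arr V ∘ h = f ∘ sub_arr U ->
  regular_epi h <->
  (forall (T : C) (y : Hom T Y), belongs y V -> in_image f U y).
Proof.
move=> sq; split=> [rh T _ [v <-]|onto].
  have [T' [e [u [re _ hu]]]] := regular_epi_in_image v rh.
  exists T', e, (sub_arr U ∘ u); split=> //; first by exists u.
  by rewrite comp_assoc -sq -!comp_assoc hu.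
have [T [e [_ [re [u <-] fu]]]] := onto _ _ (belongs_self V).
apply: (@regular_epi_factor _ _ _ u).
suff -> : h ∘ u = e by [].
by apply: (@sub_mono _ _ V); rewrite comp_assoc sq -fu comp_assoc.
Qed.

Lemma regular_epi_pullback (X Y Z Q : C) (f : Hom X Z) (g : Hom Y Z)
    (p : Hom Q X) (q : Hom Q Y) :
  is_pullback f g p q -> regular_epi g -> regular_epi p.
Proof.
move=> [_ up] rg; have [h [[hp _] _]] := up _ _ _ (proj1 (pbP f g)).
by apply: (@regular_epi_factor _ _ _ h); rewrite hp; apply: regular_epi_pb.
Qed.

(** It is enough to test preservation of pullbacks on the chosen ones, because
    any other pullback of the same cospan is isomorphic to it. *)
Lemma pres_chosen_pullbacks (D : Category) (F : Functor C D) :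
  (forall (X Y Z : C) (f : Hom X Z) (g : Hom Y Z),
     is_pullback (fmap F f) (fmap F g) (fmap F (pb1 f g)) (fmap F (pb2 f g))) ->
  forall (X Y Z Q : C) (f : Hom X Z) (g : Hom Y Z) (p : Hom Q X) (q : Hom Q Y),
    is_pullback f g p q ->
    is_pullback (fmap F f) (fmap F g) (fmap F p) (fmap F q).
Proof.
move=> chosen X Y Z Q f g p q [sq up].
have [i [ip iq]] := pb_lift sq.
have [j [[jp jq] _]] := up _ _ _ (proj1 (pbP f g)).
have ji : j ∘ i = idn Q.
  have [h [_ hu]] := up _ _ _ sq; rewrite -(hu (j ∘ i)).
    by apply: hu; rewrite !comp_idr.
  by rewrite !comp_assoc jp jq.
split=> [|T x y exy]; first by rewrite -!fmap_comp sq.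
have [h [[hx hy] hu]] := proj2 (chosen _ _ _ f g) T x y exy.
exists (fmap F j ∘ h); split.
  by rewrite !comp_assoc -!fmap_comp jp jq.
move=> k [kx ky]; rewrite (hu (fmap F i ∘ k)).
  by rewrite comp_assoc -fmap_comp ji fmap_id comp_idl.
by rewrite !comp_assoc -!fmap_comp ip iq.
Qed.

End RegularCategories.

Lemma is_pullback_id (C : Category) (X Y : C) (f : Hom X Y) :
  is_pullback f (idn Y) (idn X) f.
Proof.
split=> [|T x y]; rewrite ?comp_idl ?comp_idr // => <-; exists x.
by split; [rewrite comp_idl | move=> h []; rewrite comp_idl].
Qed.

Lemma is_terminal_one (C : RegularCategory) : is_terminal (one : C).
Proof. by move=> X; exists (bang X); split=> // f _; apply: one_uniq. Qed.

Lemma pres_chosen_terminal (C : RegularCategory) (D : Category)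
    (F : Functor C D) : is_terminal (F one) ->
  forall T : C, is_terminal T -> is_terminal (F T).
Proof.
move=> t1 T tT X; have [x [_ xu]] := t1 X; have [i _] := tT one.
exists (fmap F i ∘ x); split=> // y _.
rewrite (xu (fmap F (bang T) ∘ y)) // comp_assoc -fmap_comp.
have [j [_ ju]] := tT T.
by rewrite -(ju (i ∘ bang T)) // (ju (idn T)) // fmap_id comp_idl.
Qed.

Lemma inhabited_regular_epi (C : RegularCategory) (X T : C) (f : Hom X T) :
  inhabited_ob X -> is_terminal T -> regular_epi f.
Proof.
move=> inh tT; have [j _] := tT one; have [i [_ iu]] := tT T.
have [k [_ ku]] := tT X.
rewrite -(ku f) // (ku (j ∘ bang X)) //; apply: iso_comp_regular_epi => //.
exists (bang T); split; first exact: one_uniq.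
by rewrite -(iu (idn T)) // (iu (j ∘ bang T)).
Qed.

Lemma functor_iso (C D : Category) (F : Functor C D) (X Y : C) (f : Hom X Y) :
  is_iso f -> is_iso (fmap F f).
Proof.
by move=> [g [gf fg]]; exists (fmap F g); rewrite -!fmap_comp gf fg !fmap_id.
Qed.

(** * Regular formulas about the filter *)

Section ClassifyingCategory.
Variables (E : HeytingCategory) (P : OPCAPair E).
Let A : E := carrier (opA P).

(** Existential quantification is only along regular epimorphisms, so that
    every formula is valid when the filter is all of [A]. *)
Inductive formula : E -> Type :=
| f_top (X : E) : formula X
| f_filter : formula A
| f_pre (X Y : E) (f : Hom X Y) : formula Y -> formula X
| f_and (X : E) : formula X -> formula X -> formula X
| f_ex (X Y : E) (e : Hom X Y) : regular_epi e -> formula X -> formula Y.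

Fixpoint ext (M : RegularModel P) (X : E) (phi : formula X) : Sub (mfun M X) :=
  match phi in formula X return Sub (mfun M X) with
  | f_top X => sub_top (mfun M X)
  | f_filter => mfil M
  | f_pre _ _ f psi => preimage (fmap (mfun M) f) (ext M psi)
  | f_and _ psi chi => sub_meet (ext M psi) (ext M chi)
  | f_ex _ _ e _ psi => image (fmap (mfun M) e) (ext M psi)
  end.

Definition id_functor : Functor E E :=
  @Build_Functor E E (fun X => X) (fun _ _ f => f) (fun _ => erefl)
    (fun _ _ _ _ _ => erefl).

Definition id_regular : RegularFunctor E E.
Proof. by exists id_functor. Defined.

(** A subobject that intersects [A'] is inhabited. *)
Lemma top_is_filter : @is_filter E P E id_regular (sub_top A).
Proof.
split=> [*|*|U inh]; try exact: belongs_top.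
pose V := sub_meet U (opsub P).
have /belongs_meet [[u _] _] := belongs_self V.
have [k _] : exists k : Hom V (sub_meet (fsub id_regular U) (sub_top A)), True.
  have [|k _] := proj2 (belongs_meet (fsub id_regular U) (sub_top A)
    (sub_arr U ∘ u)); last by exists k.
  by split; [exists u | apply: belongs_top].
apply: (@regular_epi_factor _ _ _ _ k).
by rewrite (one_uniq (bang _ ∘ k) (bang V)).
Qed.

Definition trivial_model : RegularModel P := Build_RegularModel top_is_filter.

(** Because of this, the classifying category contains no arrows but those of
    [E]. *)
Lemma trivial_model_valid (X : E) (phi : formula X) (T : E) (x : Hom T X) :
  belongs x (ext trivial_model phi).
Proof.
elim: phi T x => /= {X}.
- by move=> X T x; apply: belongs_top.
- by move=> T x; apply: belongs_top.
- by move=> X Y f psi IH T x; apply/belongs_preimage.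
- by move=> X psi IH1 chi IH2 T x; apply/belongs_meet.
- move=> X Y e re psi IH T y; apply/belongs_image.
  by have [T' [d [x [rd _ ex]]]] := regular_epi_in_image y re; exists T', d, x.
Qed.

(** * The classifying category *)

(** The semantic entailment [phi x -> psi (f x)], over all regular models. *)
Definition preserves (X Y : E) (phi : formula X) (psi : formula Y)
    (f : Hom X Y) : Prop :=
  forall (M : RegularModel P) (T : mcat M) (x : Hom T (mfun M X)),
    belongs x (ext M phi) -> belongs (fmap (mfun M) f ∘ x) (ext M psi).

Record cls_ob := ClsOb { base : E; cond : formula base }.

Record cls_hom (X Y : cls_ob) := ClsHom {
  arr : Hom (base X) (base Y);
  arr_preserves : preserves (cond X) (cond Y) arr }.

Lemma cls_hom_eq (X Y : cls_ob) (f g : cls_hom X Y) : arr f = arr g -> f = g.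
Proof.
case: f g => [f pf] [g pg] /= efg; rewrite -{}efg in pg *.
by rewrite (proof_irrelevance _ pf pg).
Qed.

Lemma preserves_id (X : cls_ob) : preserves (cond X) (cond X) (idn (base X)).
Proof. by move=> M T x; rewrite fmap_id comp_idl. Qed.

Lemma preserves_comp (X Y Z : cls_ob) (g : cls_hom Y Z) (f : cls_hom X Y) :
  preserves (cond X) (cond Z) (arr g ∘ arr f).
Proof.
move=> M T x /(arr_preserves f) /(arr_preserves g).
by rewrite fmap_comp comp_assoc.
Qed.

Definition cls_cat : Category.
Proof.
refine (@Build_Category cls_ob cls_hom (fun X => ClsHom (@preserves_id X))
  (fun X Y Z g f => ClsHom (preserves_comp g f)) _ _ _).
- by move=> *; apply: cls_hom_eq; rewrite /= comp_idl.
- by move=> *; apply: cls_hom_eq; rewrite /= comp_idr.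
- by move=> *; apply: cls_hom_eq; rewrite /= comp_assoc.
Defined.

Lemma arr_comp (X Y Z : cls_cat) (g : Hom Y Z) (f : Hom X Y) :
  arr (g ∘ f) = arr g ∘ arr f.
Proof. by []. Qed.

Lemma arr_mono (X Y : cls_cat) (m : Hom X Y) : mono (arr m) -> mono m.
Proof.
by move=> mm T f g /(congr1 (@arr _ _)) /mm e; apply: cls_hom_eq.
Qed.

Section Realization.
Variable M : RegularModel P.

Lemma restrict_exists (X Y : cls_ob) (f : cls_hom X Y) :
  exists h : Hom (ext M (cond X)) (ext M (cond Y)),
    sub_arr (ext M (cond Y)) ∘ h =
    fmap (mfun M) (arr f) ∘ sub_arr (ext M (cond X)).
Proof. by apply: (arr_preserves f); apply: belongs_self. Qed.

Definition restrict (X Y : cls_ob) (f : cls_hom X Y) :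
    Hom (ext M (cond X)) (ext M (cond Y)) :=
  sval (constructive_indefinite_description _ (restrict_exists f)).

Lemma restrictE (X Y : cls_ob) (f : cls_hom X Y) :
  sub_arr (ext M (cond Y)) ∘ restrict f =
  fmap (mfun M) (arr f) ∘ sub_arr (ext M (cond X)).
Proof.
exact: (proj2_sig (constructive_indefinite_description _ (restrict_exists f))).
Qed.

Definition realize : Functor cls_cat (mcat M).
Proof.
refine (@Build_Functor cls_cat (mcat M) (fun X => sub_ob (ext M (cond X)))
  restrict _ _).
- move=> X; apply: (@sub_mono _ _ (ext M (cond X))).
  by rewrite restrictE fmap_id comp_idl comp_idr.
- move=> X Y Z g f; apply: (@sub_mono _ _ (ext M (cond Z))).
  by rewrite restrictE comp_assoc restrictE fmap_comp -!comp_assoc restrictE.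
Defined.

Lemma realizeE (X Y : cls_cat) (f : Hom X Y) :
  sub_arr (ext M (cond Y)) ∘ fmap realize f =
  fmap (mfun M) (arr f) ∘ sub_arr (ext M (cond X)).
Proof. exact: restrictE. Qed.

End Realization.

(** The arrow that the coequalizer in [E] induces preserves formulas in each
    model, as this can be checked locally, where elements satisfying [cond Y]
    come from elements satisfying [cond X]. *)
Lemma cls_coequalizer (K X Y : cls_cat) (p q : Hom K X) (f : Hom X Y) :
  (forall M, regular_epi (fmap (realize M) f)) ->
  is_coequalizer (arr p) (arr q) (arr f) -> is_coequalizer p q f.
Proof.
move=> rf [fpq uf]; split=> [|T t /(congr1 (@arr _ _)) /uf [h [hf hu]]].
  exact: cls_hom_eq.
have ph : preserves (cond Y) (cond T) h.
  move=> M S y yY.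
  have /restriction_regular_epi onto := rf M.
  have [S' [e [x [re xX fx]]]] := onto _ (realizeE M f) _ _ yY.
  apply: (belongs_descent re); rewrite -comp_assoc -fx comp_assoc -fmap_comp hf.
  exact: (arr_preserves t).
exists (ClsHom ph); split=> [|k /(congr1 (@arr _ _)) /hu e].
  exact: cls_hom_eq.
exact: cls_hom_eq.
Qed.

(** A square is a pullback as soon as it is one in [E] and the condition at its
    corner is the conjunction of the other two in every model. Then it is also
    a pullback in every model. *)
Section Pullbacks.
Variables (X Y Z Q : cls_cat) (f : Hom X Z) (g : Hom Y Z) (p : Hom Q X)
  (q : Hom Q Y).
Hypothesis pullback_arr : is_pullback (arr f) (arr g) (arr p) (arr q).
Hypothesis cond_pullback : forall (M : RegularModel P) (T : mcat M)
    (z : Hom T (mfun M (base Q))),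
  belongs (fmap (mfun M) (arr p) ∘ z) (ext M (cond X)) ->
  belongs (fmap (mfun M) (arr q) ∘ z) (ext M (cond Y)) ->
  belongs z (ext M (cond Q)).

Lemma cls_pullback : is_pullback f g p q.
Proof.
have [sq up] := pullback_arr; split=> [|T x y /(congr1 (@arr _ _)) exy].
  exact: cls_hom_eq.
have [h [[hx hy] hu]] := up _ _ _ exy.
have ph : preserves (cond T) (cond Q) h.
  move=> M S z zT; apply: cond_pullback.
    by rewrite comp_assoc -fmap_comp hx; apply: (arr_preserves x).
  by rewrite comp_assoc -fmap_comp hy; apply: (arr_preserves y).
exists (ClsHom ph); split; first by split; apply: cls_hom_eq.
move=> k [/(congr1 (@arr _ _)) kx /(congr1 (@arr _ _)) ky].
by apply: cls_hom_eq; apply: hu.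
Qed.

Lemma realize_pullback (M : RegularModel P) :
  is_pullback (fmap (realize M) f) (fmap (realize M) g)
    (fmap (realize M) p) (fmap (realize M) q).
Proof.
have [sq up] := pres_pullback (mfun M) pullback_arr.
split=> [|T x y exy].
  rewrite -!fmap_comp; suff -> : f ∘ p = g ∘ q by [].
  by apply: cls_hom_eq; apply: (proj1 pullback_arr).
have [|h [[hx hy] hu]] := up T (sub_arr (ext M (cond X)) ∘ x)
    (sub_arr (ext M (cond Y)) ∘ y).
  by rewrite !comp_assoc -!realizeE -!comp_assoc exy.
have [||k hk] := @cond_pullback M T h.
- by exists x.
- by exists y.
have kx : fmap (realize M) p ∘ k = x.
  apply: (@sub_mono _ _ (ext M (cond X))).
  by rewrite comp_assoc realizeE -comp_assoc hk.
have ky : fmap (realize M) q ∘ k = y.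
  apply: (@sub_mono _ _ (ext M (cond Y))).
  by rewrite comp_assoc realizeE -comp_assoc hk.
exists k; split=> // l [lx ly]; apply: (@sub_mono _ _ (ext M (cond Q))).
rewrite hk; apply: hu; split; rewrite comp_assoc -realizeE -comp_assoc.
  by rewrite lx.
by rewrite ly.
Qed.

End Pullbacks.

Lemma preserves_top (X Y : E) (phi : formula X) (f : Hom X Y) :
  preserves phi (f_top Y) f.
Proof. by move=> M T x _; apply: belongs_top. Qed.

Definition to_top (X : cls_ob) (Y : E) (f : Hom (base X) Y) :
    cls_hom X (ClsOb (f_top Y)) :=
  @ClsHom X (ClsOb (f_top Y)) f (@preserves_top _ _ (cond X) f).

Lemma preserves_pre (X Y : E) (f : Hom X Y) (psi : formula Y) :
  preserves (f_pre f psi) psi f.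
Proof. by move=> M T x /belongs_preimage. Qed.

Lemma preserves_and1 (X Y : E) (f : Hom X Y) (phi chi : formula X)
    (psi : formula Y) : preserves phi psi f -> preserves (f_and phi chi) psi f.
Proof. by move=> pf M T x /belongs_meet [/pf]. Qed.

Lemma preserves_and2 (X Y : E) (f : Hom X Y) (phi chi : formula X)
    (psi : formula Y) : preserves chi psi f -> preserves (f_and phi chi) psi f.
Proof. by move=> pf M T x /belongs_meet [_ /pf]. Qed.

Lemma preserves_ex (X Y : E) (e : Hom X Y) (re : regular_epi e)
    (phi : formula X) : preserves phi (f_ex re phi) e.
Proof.
move=> M T x xphi; apply/belongs_image; exists T, (idn T), x; split=> //.
  by apply: iso_regular_epi; exists (idn T); rewrite comp_idl.
by rewrite comp_idr.
Qed.

Section ChosenLimits.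
Variables X Y : cls_cat.

Definition cls_prd : cls_cat :=
  ClsOb (f_and (f_pre (@pr1 E (base X) (base Y)) (cond X))
               (f_pre (@pr2 E (base X) (base Y)) (cond Y))).

Definition cls_pr1 : Hom cls_prd X :=
  @ClsHom cls_prd X _ (preserves_and1 (@preserves_pre _ _ _ _)).

Definition cls_pr2 : Hom cls_prd Y :=
  @ClsHom cls_prd Y _ (preserves_and2 (@preserves_pre _ _ _ _)).

Lemma preserves_pairing (T : cls_cat) (x : Hom T X) (y : Hom T Y) :
  preserves (cond T) (cond cls_prd) ⟨arr x, arr y⟩.
Proof.
move=> M S z zT; apply/belongs_meet; split; apply/belongs_preimage;
  rewrite comp_assoc -fmap_comp ?pr1_pairing ?pr2_pairing;
  exact: arr_preserves.
Qed.

Variables (Z : cls_cat) (f : Hom X Z) (g : Hom Y Z).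

Definition cls_pb : cls_cat :=
  ClsOb (f_and (f_pre (pb1 (arr f) (arr g)) (cond X))
               (f_pre (pb2 (arr f) (arr g)) (cond Y))).

Definition cls_pb1 : Hom cls_pb X :=
  @ClsHom cls_pb X _ (preserves_and1 (@preserves_pre _ _ _ _)).

Definition cls_pb2 : Hom cls_pb Y :=
  @ClsHom cls_pb Y _ (preserves_and2 (@preserves_pre _ _ _ _)).

Lemma cond_cls_pb (M : RegularModel P) (T : mcat M)
    (z : Hom T (mfun M (base cls_pb))) :
  belongs (fmap (mfun M) (arr cls_pb1) ∘ z) (ext M (cond X)) ->
  belongs (fmap (mfun M) (arr cls_pb2) ∘ z) (ext M (cond Y)) ->
  belongs z (ext M (cond cls_pb)).
Proof. by move=> zX zY; apply/belongs_meet; split; apply/belongs_preimage. Qed.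

Lemma cls_pbP : is_pullback f g cls_pb1 cls_pb2.
Proof. by apply: cls_pullback; [apply: pbP | apply: cond_cls_pb]. Qed.

Lemma realize_pb (M : RegularModel P) :
  is_pullback (fmap (realize M) f) (fmap (realize M) g)
    (fmap (realize M) cls_pb1) (fmap (realize M) cls_pb2).
Proof. by apply: realize_pullback; [apply: pbP | apply: cond_cls_pb]. Qed.

End ChosenLimits.

Lemma realize_ex (M : RegularModel P) (X Y : cls_cat) (f : Hom X Y) :
  (forall (T : mcat M) (y : Hom T (mfun M (base Y))),
     belongs y (ext M (cond Y)) ->
     in_image (fmap (mfun M) (arr f)) (ext M (cond X)) y) ->
  regular_epi (fmap (realize M) f).
Proof. by move=> onto; apply/restriction_regular_epi; first exact: realizeE. Qed.

(** Factorization through the image of [arr f] in [E], with the formula that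
    quantifies [cond X] existentially. *)
Lemma cls_image (X Y : cls_cat) (f : Hom X Y) :
  exists (I : cls_cat) (q : Hom X I) (m : Hom I Y),
    [/\ m ∘ q = f, mono m,
        forall M, regular_epi (fmap (realize M) q) &
        is_coequalizer (pb1 (arr f) (arr f)) (pb2 (arr f) (arr f)) (arr q)].
Proof.
have [I [q [cq mq]]] := image_factorization (arr f).
have rq := coequalizer_regular_epi cq.
have pm : preserves (f_ex rq (cond X)) (cond Y) (sub_arr I).
  move=> M T y /belongs_image [T' [e [x [re xX qx]]]].
  apply: (belongs_descent re); rewrite -comp_assoc -qx comp_assoc -fmap_comp.
  by rewrite mq; apply: (arr_preserves f).
pose J := ClsOb (f_ex rq (cond X)).
exists J, (@ClsHom X J q (@preserves_ex _ _ _ rq (cond X))).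
exists (@ClsHom J Y _ pm); split=> //.
- exact: cls_hom_eq.
- by apply: arr_mono; apply: (@sub_mono _ _ I).
- by move=> M; apply: realize_ex => T y /belongs_image.
Qed.

(** From left to right, the mono part of the factorization of [f] is an
    isomorphism, so [f] inherits the property from its first part. From right to
    left, the trivial model shows that [arr f] is the coequalizer of its kernel
    pair. *)
Lemma cls_regular_epi (X Y : cls_cat) (f : Hom X Y) :
  regular_epi f <-> forall M, regular_epi (fmap (realize M) f).
Proof.
split=> [rf M|rf].
  have [I [q [m [mq mm rq _]]]] := cls_image f.
  have im : is_iso m.
    apply: (@sub_iso _ _ (Build_Sub mm)); apply: (belongs_descent rf).
    by rewrite comp_idl; exists q.
  rewrite -mq fmap_comp; apply: iso_comp_regular_epi => //.
  exact: functor_iso.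
have rE : regular_epi (arr f).
  have /(restriction_regular_epi (realizeE trivial_model f)) onto :=
    rf trivial_model.
  have [|T [e [x [re _ fx]]]] := onto _ (idn _).
    exact: trivial_model_valid.
  by apply: (@regular_epi_factor _ _ _ _ x); rewrite fx comp_idl.
apply: (@coequalizer_regular_epi _ _ _ _ (cls_pb1 f f) (cls_pb2 f f)).
by apply: cls_coequalizer rf _; apply: regular_epi_kernel_pair rE (pbP _ _).
Qed.

Definition cls_reg : RegularCategory.
Proof.
refine (@Build_RegularCategory cls_cat (ClsOb (f_top (one : E)))
  (fun X => @to_top X one (bang (base X))) _
  cls_prd cls_pr1 cls_pr2
  (fun T X Y x y => @ClsHom T (cls_prd X Y) _ (preserves_pairing x y)) _ _ _
  cls_pb cls_pb1 cls_pb2 cls_pbP _ _).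
- by move=> X f; apply: cls_hom_eq; apply: one_uniq.
- by move=> T X Y x y; apply: cls_hom_eq; apply: pr1_pairing.
- by move=> T X Y x y; apply: cls_hom_eq; apply: pr2_pairing.
- by move=> T X Y h; apply: cls_hom_eq; apply: pairing_uniq.
- move=> X Y f; have [I [q [m [_ _ rq cq]]]] := cls_image f.
  by exists I, q; apply: cls_coequalizer.
- move=> X Y Z f g /cls_regular_epi rg; apply/cls_regular_epi => M.
  exact: regular_epi_pullback (realize_pb f g M) (rg M).
Defined.

(** * The classifying category as a model *)

Definition free_functor : Functor E cls_reg.
Proof.
refine (@Build_Functor E cls_reg (fun X => ClsOb (f_top X))
  (fun X Y f => @to_top (ClsOb (f_top X)) Y f) _ _).
- by move=> X; apply: cls_hom_eq.
- by move=> X Y Z g f; apply: cls_hom_eq.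
Defined.

Definition free_regular : RegularFunctor E cls_reg.
Proof.
exists free_functor.
- apply: pres_chosen_terminal; exact: (@is_terminal_one cls_reg).
- move=> X Y Z Q f g p q pQ; apply: cls_pullback => // M T z _ _.
  exact: belongs_top.
- move=> X Y e re; apply/cls_regular_epi => M; apply: realize_ex => T y _.
  exact/regular_epi_in_image/pres_regular_epi.
Defined.

Definition weaken (X : cls_reg) : Hom X (free_functor (base X)) :=
  @to_top X (base X) (idn (base X)).

Lemma weaken_mono (X : cls_reg) : mono (weaken X).
Proof. by apply: arr_mono; apply: mono_id. Qed.

Definition generic_filter : Sub (free_regular A) :=
  Build_Sub (@weaken_mono (ClsOb f_filter)).

Lemma belongs_generic (T : cls_reg) (x : Hom T (free_regular A)) :
  belongs x generic_filter <-> preserves (cond T) f_filter (arr x).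
Proof.
split=> [[k <-] M S z zT|px].
  by rewrite arr_comp comp_idl; apply: (arr_preserves k).
by exists (@ClsHom T (ClsOb f_filter) _ px); apply: cls_hom_eq; apply: comp_idl.
Qed.

Section RealizeRegular.
Variable M : RegularModel P.

Lemma realize_regular_terminal (T : cls_reg) :
  is_terminal T -> is_terminal (realize M T).
Proof.
apply: (@pres_chosen_terminal cls_reg) => {T}.
exact: (pres_terminal (mfun M) (@is_terminal_one E)).
Qed.

Definition realize_regular : RegularFunctor cls_reg (mcat M).
Proof.
exists (realize M).
- exact: realize_regular_terminal.
- apply: (@pres_chosen_pullbacks cls_reg) => X Y Z f g; exact: realize_pb.
- by move=> X Y e /cls_regular_epi.
Defined.

Lemma realize_free (X Y : E) (f : Hom X Y) :
  fmap (realize M) (fmap free_functor f) = fmap (mfun M) f.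
Proof.
by have := realizeE M (fmap free_functor f); rewrite comp_idl comp_idr.
Qed.

Lemma realize_weaken (X : cls_reg) :
  fmap (realize M) (weaken X) = sub_arr (ext M (cond X)).
Proof.
by have := realizeE M (weaken X); rewrite fmap_id !comp_idl.
Qed.

End RealizeRegular.

Lemma generic_is_filter : @is_filter E P cls_reg free_regular generic_filter.
Proof.
split.
- move=> T x y /belongs_generic Cx [r [rx ry]].
  apply/belongs_generic => M S z zT.
  apply: (filter_up (mfilP M) (Cx M S z zT)).
  exists (fmap (mfun M) (arr r) ∘ z).
  by rewrite -rx -ry /= !fmap_comp !comp_assoc.
- move=> T x y w /belongs_generic Cx /belongs_generic Cy [r [rx ry rw]].
  apply/belongs_generic => M S z zT.
  apply: (filter_app (mfilP M) (Cx M S z zT) (Cy M S z zT)).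
  exists (fmap (mfun M) (arr r) ∘ z).
  by rewrite -rx -ry -rw /= !fmap_comp !comp_assoc.
- move=> U UA; apply/cls_regular_epi => M.
  have inh := filter_meets (mfilP M) UA.
  (* [realize M] turns the meet of [U] with the generic filter into a pullback
     of the same subobjects as the meet in [M], which is inhabited. *)
  have [_] := pres_pullback (realize_regular M)
    (pbP (sub_arr (fsub free_regular U)) (sub_arr generic_filter)).
  rewrite [fmap _ (sub_arr (fsub _ _))]realize_free.
  rewrite [fmap _ (sub_arr generic_filter)]realize_weaken => up.
  have [|k _] := up _ (pb1 (sub_arr (fsub (mfun M) U)) (sub_arr (mfil M)))
      (pb2 (sub_arr (fsub (mfun M) U)) (sub_arr (mfil M))).
    exact: (proj1 (pbP (sub_arr (fsub (mfun M) U)) (sub_arr (mfil M)))).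
  apply: (@regular_epi_factor _ _ _ _ k); apply: inhabited_regular_epi inh _.
  exact: realize_regular_terminal (@is_terminal_one cls_reg).
Qed.

Definition classifying_model : RegularModel P :=
  Build_RegularModel generic_is_filter.

(** * Pseudoinitiality *)

Definition realize_iso (M : RegularModel P) :
  NatIso (functor_comp (realize_regular M) free_regular) (mfun M).
Proof.
refine (@Build_NatIso E (mcat M)
  (functor_comp (realize_regular M) free_regular) (mfun M)
  (fun X => idn (mfun M X)) _ _).
- by move=> X Y f; rewrite comp_idl comp_idr; apply: realize_free.
- by move=> X; exists (idn _); rewrite comp_idl.
Defined.

Lemma realize_filter (M : RegularModel P) :
  exists k : Hom (realize_regular M generic_filter) (mfil M),
    is_iso k /\
    sub_arr (mfil M) ∘ k =
      realize_iso M A ∘ fmap (realize_regular M) (sub_arr generic_filter).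
Proof.
exists (idn _); split; first by exists (idn _); rewrite comp_idl.
by rewrite comp_idl comp_idr; apply/esym/realize_weaken.
Qed.

Definition realize_morphism (M : RegularModel P) :
    ModelMorphism classifying_model M :=
  @Build_ModelMorphism E P classifying_model M _ _ (realize_filter M).

Section Uniqueness.
Variable M : RegularModel P.

Section Subobjects.
Variable K : ModelMorphism classifying_model M.

(** The embedding of [K (X, phi)] into [K (X, true)], which is identified with
    [F X] through the natural isomorphism that is part of [K]. *)
Definition mor_arr (X : cls_reg) : Hom (mor_fun K X) (mfun M (base X)) :=
  mor_iso K (base X) ∘ fmap (mor_fun K) (weaken X).

Arguments mor_arr : simpl never.

Lemma mor_arr_mono (X : cls_reg) : mono (mor_arr X).
Proof.
apply: mono_comp; first exact: iso_mono (nat_iso (mor_iso K) (base X)).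
apply: pres_mono; exact: weaken_mono.
Qed.

Definition mor_sub (X : cls_reg) : Sub (mfun M (base X)) :=
  Build_Sub (@mor_arr_mono X).

Lemma mor_arr_natural (X Y : cls_reg) (f : Hom X Y) :
  mor_arr Y ∘ fmap (mor_fun K) f = fmap (mfun M) (arr f) ∘ mor_arr X.
Proof.
rewrite /mor_arr comp_assoc -(nat_natural (mor_iso K)) -!comp_assoc /=.
rewrite -!fmap_comp; congr (_ ∘ fmap _ _); apply: cls_hom_eq.
by rewrite /= comp_idl comp_idr.
Qed.

Lemma mor_sub_preserves (X Y : cls_reg) (f : Hom X Y) (T : mcat M)
    (t : Hom T (mfun M (base X))) :
  belongs t (mor_sub X) -> belongs (fmap (mfun M) (arr f) ∘ t) (mor_sub Y).
Proof.
move=> [u <-]; exists (fmap (mor_fun K) f ∘ u).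
by rewrite /= comp_assoc mor_arr_natural comp_assoc.
Qed.

(** Both [K] and the functor of [M] preserve the pullback, and an element of
    [F (base Q)] is determined by its two components. *)
Lemma mor_sub_pullback (X Y Z Q : cls_reg) (f : Hom X Z) (g : Hom Y Z)
    (p : Hom Q X) (q : Hom Q Y) :
  is_pullback (arr f) (arr g) (arr p) (arr q) ->
  is_pullback f g p q ->
  forall (T : mcat M) (t : Hom T (mfun M (base Q))),
    belongs (fmap (mfun M) (arr p) ∘ t) (mor_sub X) ->
    belongs (fmap (mfun M) (arr q) ∘ t) (mor_sub Y) ->
    belongs t (mor_sub Q).
Proof.
move=> pE pN T t [u pu] [v qv]; rewrite /= in pu qv.
have [sq up] := pres_pullback (mfun M) pE.
have [|w [[wu wv] _]] := proj2 (pres_pullback (mor_fun K) pN) T u v.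
  apply: (@mor_arr_mono Z); rewrite comp_assoc mor_arr_natural -comp_assoc pu.
  rewrite comp_assoc sq -comp_assoc -qv.
  by rewrite [RHS]comp_assoc mor_arr_natural comp_assoc.
exists w; have [|h [_ hu]] := up T (fmap (mfun M) (arr p) ∘ t)
    (fmap (mfun M) (arr q) ∘ t); first by rewrite !comp_assoc sq.
rewrite -(hu t) // (hu (mor_arr Q ∘ w)) // -pu -qv -wu -wv.
by split; rewrite comp_assoc -mor_arr_natural comp_assoc.
Qed.

Lemma mor_arr_free (X : E) : mor_arr (free_functor X) = mor_iso K X.
Proof.
rewrite /mor_arr; have -> : weaken (free_functor X) = idn _.
  exact: cls_hom_eq.
by rewrite fmap_id; apply: comp_idr.
Qed.

Lemma mor_sub_top (X : E) (T : mcat M) (t : Hom T (mfun M X)) :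
  belongs t (mor_sub (ClsOb (f_top X))).
Proof.
have [h [_ hK]] := nat_iso (mor_iso K) X; exists (h ∘ t).
by rewrite comp_assoc [sub_arr _]mor_arr_free hK comp_idl.
Qed.

(** A morphism of models has no choice: its value at a formula is the extension
    of this formula. Substitution and conjunction are pullbacks of objects with
    simpler formulas, and the object [(Y, exists x. e x = y and psi x)] is the
    target of a regular epimorphism from [(X, psi)]. *)
Lemma mor_subE (X : E) (phi : formula X) (T : mcat M) (t : Hom T (mfun M X)) :
  belongs t (mor_sub (ClsOb phi)) <-> belongs t (ext M phi).
Proof.
elim: phi T t => {X} [X|//|X Y f psi IH|X psi IH1 chi IH2|X Y e re psi IH] T t.
- by split=> _; [apply: belongs_top | apply: mor_sub_top].
- have [k [[l [_ kl]] ek]] := mor_fil K.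
  have {}ek : mor_arr (ClsOb f_filter) = sub_arr (mfil M) ∘ k by rewrite ek.
  split=> [[u <-]|[u <-]].
    by exists (k ∘ u); rewrite comp_assoc -ek.
  by exists (l ∘ u); rewrite /= ek -comp_assoc (comp_assoc k) kl comp_idl.
- pose Q : cls_reg := ClsOb (f_pre f psi).
  pose Yt : cls_reg := ClsOb (f_top Y).
  pose Xt : cls_reg := ClsOb (f_top X).
  pose q : @Hom cls_reg Q (ClsOb psi) :=
    @ClsHom Q (ClsOb psi) f (@preserves_pre _ _ _ _).
  have sq := is_pullback_id f.
  split=> [tQ|/belongs_preimage tY].
    by apply/belongs_preimage/IH; apply: (mor_sub_preserves q).
  apply: (@mor_sub_pullback Xt (ClsOb psi) Yt Q (fmap free_functor f)
    (weaken _) (weaken Q) q sq) => /=; first last.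
  + exact/IH.
  + exact: mor_sub_top.
  + by apply: cls_pullback => // N S z _ zY; apply/belongs_preimage.
- pose Q : cls_reg := ClsOb (f_and psi chi).
  pose p : @Hom cls_reg Q (ClsOb psi) := @ClsHom Q (ClsOb psi) (idn X)
    (preserves_and1 (@preserves_id (ClsOb psi))).
  pose q : @Hom cls_reg Q (ClsOb chi) := @ClsHom Q (ClsOb chi) (idn X)
    (preserves_and2 (@preserves_id (ClsOb chi))).
  have sq := is_pullback_id (idn X).
  split=> [tQ|/belongs_meet [/IH1 t1 /IH2 t2]].
    have := mor_sub_preserves p tQ; have := mor_sub_preserves q tQ.
    by rewrite /= fmap_id comp_idl => /IH2 t2 /IH1 t1; apply/belongs_meet.
  apply: (@mor_sub_pullback (ClsOb psi) (ClsOb chi) (ClsOb (f_top X)) Q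
    (weaken _) (weaken _) p q sq) => /=; rewrite ?fmap_id ?comp_idl //.
  apply: cls_pullback => // N S z; rewrite /= fmap_id comp_idl => z1 z2.
  exact/belongs_meet.
- pose Q : cls_reg := ClsOb (f_ex re psi).
  pose q : @Hom cls_reg (ClsOb psi) Q :=
    @ClsHom (ClsOb psi) Q e (@preserves_ex _ _ _ _ _).
  have rq : regular_epi q.
    by apply/cls_regular_epi => N; apply: realize_ex => S y /belongs_image.
  split=> [[u <-]|/belongs_image [T' [d [x [rd /IH xX ex]]]]].
    apply/belongs_image.
    have [T' [d [v [rd _ qv]]]] :=
      regular_epi_in_image u (pres_regular_epi (mor_fun K) rq).
    exists T', d, (mor_arr (ClsOb psi) ∘ v); split=> //.
      by apply/IH; exists v.
    by rewrite comp_assoc -(mor_arr_natural q) -!comp_assoc qv.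
  apply: (belongs_descent rd); rewrite -ex; exact: (mor_sub_preserves q).
Qed.

End Subobjects.

Lemma mor_iso_exists (K L : ModelMorphism classifying_model M) (X : cls_reg) :
  exists h : Hom (mor_fun K X) (mor_fun L X), mor_arr L X ∘ h = mor_arr K X.
Proof.
case: X => X phi; have /mor_subE/mor_subE := belongs_self (mor_sub K (ClsOb phi)).
by move=> /(_ L).
Qed.

Definition mor_iso_at (K L : ModelMorphism classifying_model M) (X : cls_reg) :
    Hom (mor_fun K X) (mor_fun L X) :=
  sval (constructive_indefinite_description _ (mor_iso_exists K L X)).

Lemma mor_iso_atE (K L : ModelMorphism classifying_model M) (X : cls_reg) :
  mor_arr L X ∘ mor_iso_at K L X = mor_arr K X.
Proof.
exact: (proj2_sig
  (constructive_indefinite_description _ (mor_iso_exists K L X))).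
Qed.

(** The comparison maps commute with the monos [mor_arr] into the values of the
    functor of [M], and this forces that they are inverse to each other and
    natural. *)
Lemma mor_unique (K L : ModelMorphism classifying_model M) : mor_isomorphic K L.
Proof.
have inv (K' L' : ModelMorphism classifying_model M) X :
    mor_iso_at L' K' X ∘ mor_iso_at K' L' X = idn _.
  apply: (@mor_arr_mono K' X).
  by rewrite comp_assoc !mor_iso_atE comp_idr.
have nat (X Y : cls_reg) (f : Hom X Y) :
    mor_iso_at K L Y ∘ fmap (mor_fun K) f =
    fmap (mor_fun L) f ∘ mor_iso_at K L X.
  apply: (@mor_arr_mono L Y).
  rewrite comp_assoc mor_iso_atE mor_arr_natural.
  by rewrite comp_assoc mor_arr_natural -comp_assoc mor_iso_atE.
have isos X : is_iso (mor_iso_at K L X) by exists (mor_iso_at L K X).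
exists (@Build_NatIso _ _ (mor_fun K) (mor_fun L) (mor_iso_at K L) nat isos).
by move=> X; have := mor_iso_atE K L (free_functor X); rewrite !mor_arr_free.
Qed.

End Uniqueness.
End ClassifyingCategory.

Theorem theorem15 (E : HeytingCategory) (P : OPCAPair E) :
  exists M : RegularModel P, pseudoinitial M.
Proof.
exists (classifying_model P) => M.
by split; [exists; apply: realize_morphism | apply: mor_unique].
Qed.
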